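(* Let $a_0,b_0:\mathbb{R}\to\mathbb{R}$ be $C^1$-functions with $a_0$ even and $b_0$ odd (in particular $b_0(0)=0$), and define for $x\in\mathbb{R}$ the two even primitive functions $$A_0(x)=\int_0^x u\,a_0(u)\,du,\qquad B_0(x)=\int_0^x b_0(u)\,du .$$ The solution $(a,b)$ of the linear system $$\frac{\partial}{\partial t}(x^2a)+\frac{\partial}{\partial x}(x^2b)=0,\qquad \frac{\partial}{\partial t}(x^2b)+\frac{\partial}{\partial x}\Big(\frac{x^2}{3}a\Big)=\frac{2x}{3}a$$ satisfying the initial conditions $$\lim_{t\downarrow0}a(t,x)=a_0(x),\qquad \lim_{t\downarrow0}b(t,x)=b_0(x),\qquad x>0,$$ is given for all $t>0$, $x>0$ by $$\begin{aligned} a(t,x)=\;&\frac{1}{2x}\Big(x+\frac{t}{\sqrt3}\Big)a_0\Big(x+\frac{t}{\sqrt3}\Big)+\frac{1}{2x}\Big(x-\frac{t}{\sqrt3}\Big)a_0\Big(x-\frac{t}{\sqrt3}\Big)\\ &-\frac{\sqrt3}{2x}\Big[\Big(x+\frac{t}{\sqrt3}\Big)b_0\Big(x+\frac{t}{\sqrt3}\Big)+B_0\Big(x+\frac{t}{\sqrt3}\Big)\Big]\\ &+\frac{\sqrt3}{2x}\Big[\Big(x-\frac{t}{\sqrt3}\Big)b_0\Big(x-\frac{t}{\sqrt3}\Big)+B_0\Big(x-\frac{t}{\sqrt3}\Big)\Big], \end{aligned}$$ $$\begin{aligned} b(t,x)=\;&-\frac{1}{2\sqrt3\,x}\Big[\Big(x+\frac{t}{\sqrt3}\Big)a_0\Big(x+\frac{t}{\sqrt3}\Big)-\frac1x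 A_0\Big(x+\frac{t}{\sqrt3}\Big)\Big]\\ &+\frac{1}{2\sqrt3\,x}\Big[\Big(x-\frac{t}{\sqrt3}\Big)a_0\Big(x-\frac{t}{\sqrt3}\Big)-\frac1x A_0\Big(x-\frac{t}{\sqrt3}\Big)\Big]\\ &+\frac{1}{2x}\Big[\Big(x+\frac{t}{\sqrt3}\Big)b_0\Big(x+\frac{t}{\sqrt3}\Big)-\frac1x\cdot\frac{t}{\sqrt3}\,B_0\Big(x+\frac{t}{\sqrt3}\Big)\Big]\\ &+\frac{1}{2x}\Big[\Big(x-\frac{t}{\sqrt3}\Big)b_0\Big(x-\frac{t}{\sqrt3}\Big)+\frac1x\cdot\frac{t}{\sqrt3}\,B_0\Big(x-\frac{t}{\sqrt3}\Big)\Big]. \end{aligned}$$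
   Context: The linear system is the linearization at the state $(a,b)=(a,0)$ of the radially symmetric ultra-relativistic Euler equations; $x>0$ is the radius variable and $t>0$ is time. The initial data, originally prescribed for $x\ge 0$ with $b_0(0)=0$, are extended to $\mathbb{R}$ by $a_0(-x)=a_0(x)$ and $b_0(-x)=-b_0(x)$ for $x>0$, and the extended functions are assumed to be $C^1$ on $\mathbb{R}$.
   Formalization: The solution is taken to be C^1 for t,x>0 and is also required to satisfy x^2 b(t,x) -> 0 as x -> 0+ for each t>0; without this, zero data admit nonzero solutions emitted from x=0. The given formulas are proved to satisfy the condition. *)

(* Defs.v *)
From Stdlib Require Import Reals.
From Coquelicot Require Import Coquelicot.
Open Scope R_scope.

Definition even_fun (f : R -> R) : Prop := forall x, f (- x) = f x.
Definition odd_fun (f : R -> R) : Prop := forall x, f (- x) = - f x.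

Definition is_C1 (f : R -> R) : Prop :=
  (forall x, ex_derive f x) /\ (forall x, continuous (Derive f) x).

(** Functions of (t, x) take the time first.  Existence and joint continuity of
    both partial derivatives on the open quadrant is continuous
    differentiability there. *)
Definition C1_quadrant (f : R -> R -> R) : Prop :=
  forall t x, 0 < t -> 0 < x ->
    ex_derive (fun s => f s x) t /\
    ex_derive (fun y => f t y) x /\
    continuity_2d_pt (fun s y => Derive (fun s' => f s' y) s) t x /\
    continuity_2d_pt (fun s y => Derive (fun y' => f s y') y) t x.

(** [Derive] is total; the equations are only used together with [C1_quadrant],
    which makes every derivative below an actual one. *)
Definition linear_system (a b : R -> R -> R) : Prop :=
  forall t x, 0 < t -> 0 < x ->
    Derive (fun s => x ^ 2 * a s x) t + Derive (fun y => y ^ 2 * b t y) x = 0 /\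
    Derive (fun s => x ^ 2 * b s x) t + Derive (fun y => y ^ 2 / 3 * a t y) x
      = 2 * x / 3 * a t x.

Definition initial_conditions (a0 b0 : R -> R) (a b : R -> R -> R) : Prop :=
  forall x, 0 < x ->
    filterlim (fun t => a t x) (at_right 0) (locally (a0 x)) /\
    filterlim (fun t => b t x) (at_right 0) (locally (b0 x)).

(** No flux through the centre of symmetry.  The system and the initial
    conditions on x > 0 alone do not determine a solution: if H is smooth and
    vanishes on (-oo, 0], there is a solution with zero initial data and
    a(t, x) = H (t / sqrt 3 - x) / x, emitted by a point source at x = 0.
    The condition holds in particular whenever b(t, .) is bounded near 0, hence
    whenever b(t, .) extends to a continuous odd function of x. *)
Definition no_flux_at_centre (b : R -> R -> R) : Prop :=
  forall t, 0 < t ->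
    filterlim (fun x => x ^ 2 * b t x) (at_right 0) (locally 0).

Definition is_solution (a0 b0 : R -> R) (a b : R -> R -> R) : Prop :=
  C1_quadrant a /\ C1_quadrant b /\
  linear_system a b /\
  initial_conditions a0 b0 a b /\
  no_flux_at_centre b.

Definition A_prim (a0 : R -> R) (x : R) : R := RInt (fun u => u * a0 u) 0 x.
Definition B_prim (b0 : R -> R) (x : R) : R := RInt b0 0 x.

Definition a_formula (a0 b0 : R -> R) (t x : R) : R :=
  let B0 := B_prim b0 in
  let r := t / sqrt 3 in
    1 / (2 * x) * (x + r) * a0 (x + r)
  + 1 / (2 * x) * (x - r) * a0 (x - r)
  - sqrt 3 / (2 * x) * ((x + r) * b0 (x + r) + B0 (x + r))
  + sqrt 3 / (2 * x) * ((x - r) * b0 (x - r) + B0 (x - r)).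

Definition b_formula (a0 b0 : R -> R) (t x : R) : R :=
  let A0 := A_prim a0 in
  let B0 := B_prim b0 in
  let r := t / sqrt 3 in
  - (1 / (2 * sqrt 3 * x)) * ((x + r) * a0 (x + r) - 1 / x * A0 (x + r))
  + 1 / (2 * sqrt 3 * x) * ((x - r) * a0 (x - r) - 1 / x * A0 (x - r))
  + 1 / (2 * x) * ((x + r) * b0 (x + r) - 1 / x * r * B0 (x + r))
  + 1 / (2 * x) * ((x - r) * b0 (x - r) + 1 / x * r * B0 (x - r)).

(* Main.v *)
Require Import Defs.
From Stdlib Require Import Reals Lra.
From Coquelicot Require Import Coquelicot.
Open Scope R_scope.

(** In the time [r = t / sqrt 3] the second equation reads
    [(sqrt 3 * b)_r + a_x = 0], so there is a velocity potential [phi] with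
    [phi_r = a] and [phi_x = - sqrt 3 * b].  Then [w = x * phi] solves
    [w_rr = w_xx]: the quantities [w_r + w_x] and [w_r - w_x], which only
    involve [a], [b] and [phi], are constant along [x + r] and [x - r], whence
    [w = F (x + r) + G (x - r)] with [F] defined on [(0, oo)] and [G] on [R].
    The initial data prescribe [F' - G'] and [F + G - x (F' + G')] on [x > 0],
    and the absence of flux at the centre gives [F r + G (- r) = 0].  For two
    solutions the differences of the profiles satisfy [F' = G'] and
    [S = x S'] with [S = F + G], hence are affine, and affine profiles of this
    kind contribute nothing to [a] and [b].  The stated formulas have the
    profiles [F y = (A0 y - sqrt 3 * y * B0 y) / 2] and
    [G y = - (A0 y + sqrt 3 * y * B0 y) / 2]. *)

(** * Neighbourhoods in the quadrant and derivatives of integrals *)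

Lemma sqrt3_pos : 0 < sqrt 3.
Proof. apply sqrt_lt_R0; lra. Qed.

Lemma sqrt3_sqr : sqrt 3 * sqrt 3 = 3.
Proof. apply sqrt_sqrt; lra. Qed.

Lemma locally_gt (m x : R) : m < x -> locally x (fun y => m < y).
Proof. intros Hx. exact (open_gt m x Hx). Qed.

Lemma locally_2d_quadrant (t x : R) :
  0 < t -> 0 < x -> locally_2d (fun s y => 0 < s /\ 0 < y) t x.
Proof.
  intros Ht Hx.
  assert (Hm : 0 < Rmin t x) by (apply Rmin_glb_lt; assumption).
  exists (mkposreal _ Hm); simpl; intros s y Hs Hy.
  apply Rabs_lt_between in Hs; apply Rabs_lt_between in Hy.
  pose proof (Rmin_l t x); pose proof (Rmin_r t x); lra.
Qed.

(** The segment from [a] to any point near [x] stays to the right of [m], so continuity on that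
    half-line is enough. This serves profiles and functions controlled only on positive
    arguments. *)
Lemma is_derive_RInt_gt (f : R -> R) (m a x : R) :
  m < a -> m < x -> (forall y, m < y -> continuous f y) ->
  is_derive (RInt f a) x (f x).
Proof.
  intros Ha Hx Hf.
  apply (is_derive_RInt f (RInt f a) a x); [ | now apply Hf].
  apply filter_imp with (2 := locally_gt m x Hx); intros y Hy.
  apply (RInt_correct (V := R_CompleteNormedModule)).
  apply (ex_RInt_continuous (V := R_CompleteNormedModule)); intros z Hz.
  apply Hf. apply Rlt_le_trans with (2 := proj1 Hz).
  now apply Rmin_glb_lt.
Qed.

Lemma is_derive_RInt_continuous (f : R -> R) (a x : R) :
  (forall y, continuous f y) -> is_derive (RInt f a) x (f x).
Proof.
  intros Hf. apply is_derive_RInt_gt with (m := Rmin a x - 1).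
  - pose proof (Rmin_l a x); lra.
  - pose proof (Rmin_r a x); lra.
  - intros y _; apply Hf.
Qed.

(** * Calculus of continuously differentiable functions on the open quadrant *)

(** The partial derivatives are carried as explicit functions, so that sums, products and
    compositions deliver formulas for them along with their continuity. *)
Definition has_gradient (u ut ux : R -> R -> R) : Prop :=
  forall t x, 0 < t -> 0 < x ->
    is_derive (fun s => u s x) t (ut t x) /\
    is_derive (fun y => u t y) x (ux t x) /\
    continuity_2d_pt ut t x /\ continuity_2d_pt ux t x.

Lemma C1_quadrant_gradient (u : R -> R -> R) :
  C1_quadrant u ->
  has_gradient u (fun t x => Derive (fun s => u s x) t)
                 (fun t x => Derive (fun y => u t y) x).
Proof.
  intros Hu t x Ht Hx. destruct (Hu t x Ht Hx) as (H1 & H2 & H3 & H4).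
  repeat split; trivial; apply Derive_correct; assumption.
Qed.

Lemma gradient_C1_quadrant (u ut ux : R -> R -> R) :
  has_gradient u ut ux -> C1_quadrant u.
Proof.
  intros Hu t x Ht Hx. destruct (Hu t x Ht Hx) as (H1 & H2 & H3 & H4).
  repeat split.
  - eexists; exact H1.
  - eexists; exact H2.
  - apply continuity_2d_pt_ext_loc with (2 := H3).
    apply locally_2d_impl with (2 := locally_2d_quadrant t x Ht Hx).
    apply locally_2d_forall; intros s y [Hs Hy].
    symmetry; apply is_derive_unique, (Hu s y Hs Hy).
  - apply continuity_2d_pt_ext_loc with (2 := H4).
    apply locally_2d_impl with (2 := locally_2d_quadrant t x Ht Hx).
    apply locally_2d_forall; intros s y [Hs Hy].
    symmetry; apply is_derive_unique, (Hu s y Hs Hy).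
Qed.

(** Continuity of the partial derivatives turns them into a total derivative, as the chain rule
    along slanted lines requires. *)
Lemma gradient_differentiable (u ut ux : R -> R -> R) :
  has_gradient u ut ux ->
  forall t x, 0 < t -> 0 < x -> differentiable_pt_lim u t x (ut t x) (ux t x).
Proof.
  intros Hu t x Ht Hx.
  apply filterdiff_differentiable_pt_lim.
  apply (is_derive_filterdiff u t x ut (ux t x)).
  - apply (locally_2d_locally (fun s y => is_derive (fun z => u z y) s (ut s y))).
    apply locally_2d_impl with (2 := locally_2d_quadrant t x Ht Hx).
    apply locally_2d_forall; intros s y [Hs Hy]. apply (Hu s y Hs Hy).
  - apply (Hu t x Ht Hx).
  - apply continuity_2d_pt_filterlim, (Hu t x Ht Hx).
Qed.

Lemma gradient_continuity (u ut ux : R -> R -> R) :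
  has_gradient u ut ux ->
  forall t x, 0 < t -> 0 < x -> continuity_2d_pt u t x.
Proof.
  intros Hu t x Ht Hx. apply differentiable_continuity_pt.
  exists (ut t x), (ux t x). now apply gradient_differentiable.
Qed.

Lemma gradient_ext (u v ut ux vt vx : R -> R -> R) :
  has_gradient u ut ux ->
  (forall t x, 0 < t -> 0 < x ->
     u t x = v t x /\ ut t x = vt t x /\ ux t x = vx t x) ->
  has_gradient v vt vx.
Proof.
  intros Hu E t x Ht Hx. destruct (Hu t x Ht Hx) as (H1 & H2 & H3 & H4).
  destruct (E t x Ht Hx) as (_ & <- & <-).
  split; [ | split; [ | split]].
  - refine (is_derive_ext_loc _ _ _ _ _ H1).
    apply filter_imp with (2 := locally_gt 0 t Ht); intros s Hs. now apply E.
  - refine (is_derive_ext_loc _ _ _ _ _ H2).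
    apply filter_imp with (2 := locally_gt 0 x Hx); intros y Hy. now apply E.
  - apply continuity_2d_pt_ext_loc with (2 := H3).
    apply locally_2d_impl with (2 := locally_2d_quadrant t x Ht Hx).
    apply locally_2d_forall; intros s y [Hs Hy]. now apply E.
  - apply continuity_2d_pt_ext_loc with (2 := H4).
    apply locally_2d_impl with (2 := locally_2d_quadrant t x Ht Hx).
    apply locally_2d_forall; intros s y [Hs Hy]. now apply E.
Qed.

(** Supplies the constants, the coordinate [x] and the characteristic variables [x + k * t] to the
    rules below. *)
Lemma gradient_affine (k l c : R) :
  has_gradient (fun t x => k * t + l * x + c) (fun _ _ => k) (fun _ _ => l).
Proof.
  intros t x _ _. split; [ | split; [ | split]];
    try apply continuity_2d_pt_const; auto_derive; trivial; ring.
Qed.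

Lemma gradient_plus (u ut ux v vt vx : R -> R -> R) :
  has_gradient u ut ux -> has_gradient v vt vx ->
  has_gradient (fun t x => u t x + v t x) (fun t x => ut t x + vt t x)
    (fun t x => ux t x + vx t x).
Proof.
  intros Hu Hv t x Ht Hx.
  destruct (Hu t x Ht Hx) as (U1 & U2 & U3 & U4).
  destruct (Hv t x Ht Hx) as (V1 & V2 & V3 & V4).
  split; [ | split; [ | split]].
  - exact (is_derive_plus _ _ _ _ _ U1 V1).
  - exact (is_derive_plus _ _ _ _ _ U2 V2).
  - now apply continuity_2d_pt_plus.
  - now apply continuity_2d_pt_plus.
Qed.

Lemma gradient_mult (u ut ux v vt vx : R -> R -> R) :
  has_gradient u ut ux -> has_gradient v vt vx ->
  has_gradient (fun t x => u t x * v t x)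
    (fun t x => ut t x * v t x + u t x * vt t x)
    (fun t x => ux t x * v t x + u t x * vx t x).
Proof.
  intros Hu Hv t x Ht Hx.
  pose proof (gradient_continuity _ _ _ Hu t x Ht Hx) as U0.
  pose proof (gradient_continuity _ _ _ Hv t x Ht Hx) as V0.
  destruct (Hu t x Ht Hx) as (U1 & U2 & U3 & U4).
  destruct (Hv t x Ht Hx) as (V1 & V2 & V3 & V4).
  split; [ | split; [ | split]].
  - exact (is_derive_mult _ _ _ _ _ U1 V1 Rmult_comm).
  - exact (is_derive_mult _ _ _ _ _ U2 V2 Rmult_comm).
  - apply continuity_2d_pt_plus; now apply continuity_2d_pt_mult.
  - apply continuity_2d_pt_plus; now apply continuity_2d_pt_mult.
Qed.

Lemma gradient_scal (k : R) (u ut ux : R -> R -> R) :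
  has_gradient u ut ux ->
  has_gradient (fun t x => k * u t x) (fun t x => k * ut t x)
    (fun t x => k * ux t x).
Proof.
  intros Hu.
  apply gradient_ext with
    (1 := gradient_mult _ _ _ _ _ _ (gradient_affine 0 0 k) Hu).
  intros t x _ _; repeat split; ring.
Qed.

Lemma gradient_comp (F f : R -> R) (u ut ux : R -> R -> R) :
  has_gradient u ut ux ->
  (forall t x, 0 < t -> 0 < x ->
     is_derive F (u t x) (f (u t x)) /\ continuous f (u t x)) ->
  has_gradient (fun t x => F (u t x)) (fun t x => ut t x * f (u t x))
    (fun t x => ux t x * f (u t x)).
Proof.
  intros Hu HF t x Ht Hx.
  pose proof (gradient_continuity _ _ _ Hu t x Ht Hx) as U0.
  destruct (Hu t x Ht Hx) as (U1 & U2 & U3 & U4).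
  destruct (HF t x Ht Hx) as [F1 F2].
  apply continuity_pt_filterlim in F2.
  split; [ | split; [ | split]].
  - exact (is_derive_comp _ _ _ _ _ F1 U1).
  - exact (is_derive_comp F (u t) _ _ _ F1 U2).
  - apply continuity_2d_pt_mult; trivial. now apply continuity_1d_2d_pt_comp.
  - apply continuity_2d_pt_mult; trivial. now apply continuity_1d_2d_pt_comp.
Qed.

(** The quadrant is convex, so the segment stays inside; by the chain rule the derivative along it
    is the assumed zero. Both the transport along characteristics and the constancy of a function
    with zero gradient come from this. *)
Lemma gradient_constant_on_segment (u ut ux : R -> R -> R) (t1 x1 t2 x2 : R) :
  has_gradient u ut ux -> 0 < t1 -> 0 < x1 -> 0 < t2 -> 0 < x2 ->
  (forall t x, 0 < t -> 0 < x ->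
     ut t x * (t2 - t1) + ux t x * (x2 - x1) = 0) ->
  u t1 x1 = u t2 x2.
Proof.
  intros Hu Ht1 Hx1 Ht2 Hx2 E.
  set (t := fun l => t1 + l * (t2 - t1)).
  set (x := fun l => x1 + l * (x2 - x1)).
  replace (u t1 x1) with (u (t 0) (x 0)) by (unfold t, x; f_equal; ring).
  replace (u t2 x2) with (u (t 1) (x 1)) by (unfold t, x; f_equal; ring).
  apply (eq_is_derive (fun l => u (t l) (x l)) 0 1); [intros l Hl | lra].
  assert (Ht : 0 < t l) by (unfold t; nra).
  assert (Hx : 0 < x l) by (unfold x; nra).
  change (zero (G := R_NormedModule)) with 0. rewrite <- (E (t l) (x l) Ht Hx).
  apply is_derive_Reals, derivable_pt_lim_comp_2d.
  - now apply gradient_differentiable.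
  - apply is_derive_Reals; unfold t; auto_derive; trivial; ring.
  - apply is_derive_Reals; unfold x; auto_derive; trivial; ring.
Qed.

(** * The reduced system and the potential of a closed form *)

(** The source [2 * x / 3 * a] cancels against the derivative of the weight [x ^ 2 / 3]; what
    remains is divided by [x] in the first equation and by [x ^ 2 / 3] in the second. *)
Lemma linear_system_gradient (a aT ax b bt bx : R -> R -> R) :
  has_gradient a aT ax -> has_gradient b bt bx ->
  (linear_system a b <->
   forall t x, 0 < t -> 0 < x ->
     x * aT t x + x * bx t x + 2 * b t x = 0 /\ 3 * bt t x + ax t x = 0).
Proof.
  intros Ha Hb.
  assert (E : forall t x, 0 < t -> 0 < x ->
    Derive (fun s => x ^ 2 * a s x) t = x ^ 2 * aT t x /\
    Derive (fun y => y ^ 2 * b t y) x = 2 * x * b t x + x ^ 2 * bx t x /\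
    Derive (fun s => x ^ 2 * b s x) t = x ^ 2 * bt t x /\
    Derive (fun y => y ^ 2 / 3 * a t y) x
      = 2 * x / 3 * a t x + x ^ 2 / 3 * ax t x).
  { intros t x Ht Hx.
    destruct (Ha t x Ht Hx) as (A1 & A2 & _), (Hb t x Ht Hx) as (B1 & B2 & _).
    assert (D1 : is_derive (fun y => y ^ 2) x (2 * x))
      by (auto_derive; trivial; ring).
    assert (D2 : is_derive (fun y => y ^ 2 / 3) x (2 * x / 3))
      by (auto_derive; trivial; field).
    repeat split; apply is_derive_unique.
    - exact (is_derive_scal _ _ _ _ A1).
    - exact (is_derive_mult _ _ _ _ _ D1 B2 Rmult_comm).
    - exact (is_derive_scal _ _ _ _ B1).
    - exact (is_derive_mult _ _ _ _ _ D2 A2 Rmult_comm). }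
  split; intros H t x Ht Hx; specialize (H t x Ht Hx);
    specialize (E t x Ht Hx); destruct E as (E1 & E2 & E3 & E4), H as [H1 H2];
    rewrite E1, E2, E3, E4 in *; split.
  - apply Rmult_eq_reg_l with x; lra.
  - apply Rmult_eq_reg_l with (x ^ 2); [lra | nra].
  - nra.
  - nra.
Qed.

Lemma continuity_2d_pt_section (u : R -> R -> R) (t x : R) :
  continuity_2d_pt u t x -> continuous (u t) x.
Proof.
  intros Hu. apply continuity_2d_pt_filterlim in Hu.
  refine (filterlim_comp _ _ _ (fun y => (t, y)) _ _ _ _ _ Hu).
  intros P [e He]. exists e; intros y Hy. apply He.
  split; [apply ball_center | exact Hy].
Qed.

Lemma continuous_ext_gt (f g : R -> R) (m x : R) :
  m < x -> (forall y, m < y -> f y = g y) -> continuous f x -> continuous g x.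
Proof.
  intros Hx E. apply continuous_ext_loc.
  exact (filter_imp _ _ E (locally_gt m x Hx)).
Qed.

Lemma pos_of_Rmin_le (a b y : R) : 0 < a -> 0 < b -> Rmin a b <= y -> 0 < y.
Proof. intros Ha Hb Hy. pose proof (Rmin_glb_lt a b 0 Ha Hb); lra. Qed.

(** Poincaré lemma for [p dt + q dx]: closedness is expressed by the shared function [px], which is
    both the [x]-derivative of [p] and the [t]-derivative of [q]. The potential integrates along the
    path from (1, 1) to (t, 1) to (t, x). *)
Lemma gradient_potential (p q pt px qx : R -> R -> R) :
  has_gradient p pt px -> has_gradient q px qx ->
  exists phi, has_gradient phi p q.
Proof.
  intros Hp Hq.
  assert (Cq : forall t, 0 < t -> forall y, 0 < y -> continuous (q t) y)
    by (intros t Ht y Hy; apply (ex_derive_continuous (q t) y);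
        eexists; apply (Hq t y Ht Hy)).
  assert (Cp : forall y, 0 < y -> continuous (fun s => p s 1) y)
    by (intros y Hy; apply (ex_derive_continuous (fun s => p s 1) y);
        eexists; apply (Hp y 1 Hy Rlt_0_1)).
  exists (fun t x => RInt (q t) 1 x + RInt (fun s => p s 1) 1 t).
  intros t x Ht Hx. split; [ | split; [ | split]].
  (* Differentiation under the integral yields the integral of [px t], that is [p t x - p t 1]; the
     second integral contributes the missing [p t 1]. *)
  - assert (D : RInt (fun y => Derive (fun s => q s y) t) 1 x = p t x - p t 1).
    { rewrite (RInt_ext _ (px t)).
      - apply is_RInt_unique, (is_RInt_derive (p t) (px t)).
        + intros y Hy. apply (Hp t y Ht).
          now apply (pos_of_Rmin_le 1 x); [lra | | ].
        + intros y Hy. apply continuity_2d_pt_section, (Hp t y Ht).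
          now apply (pos_of_Rmin_le 1 x); [lra | | ].
      - intros y [Hy _]. apply is_derive_unique, (Hq t y Ht).
        apply (pos_of_Rmin_le 1 x); lra. }
    replace (p t x) with ((p t x - p t 1) + p t 1) by ring.
    rewrite <- D.
    refine (is_derive_plus (fun s => RInt (q s) 1 x) (fun s => RInt (fun r => p r 1) 1 s)
      _ _ _ _ _).
    + apply (is_derive_RInt_param q).
      * apply filter_imp with (2 := locally_gt 0 t Ht).
        intros s Hs y [Hy _]. eexists; apply (Hq s y Hs).
        now apply (pos_of_Rmin_le 1 x); [lra | | ].
      * intros y [Hy _]. apply (gradient_C1_quadrant _ _ _ Hq); trivial.
        now apply (pos_of_Rmin_le 1 x); [lra | | ].
      * apply filter_imp with (2 := locally_gt 0 t Ht). intros s Hs.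
        apply (ex_RInt_continuous (V := R_CompleteNormedModule)).
        intros y [Hy _]. apply Cq; trivial.
        now apply (pos_of_Rmin_le 1 x); [lra | | ].
    + apply (is_derive_RInt_gt (fun s => p s 1) 0); [lra | easy | exact Cp].
  - replace (q t x) with (q t x + 0) by ring.
    refine (is_derive_plus (RInt (q t) 1) (fun _ => RInt (fun r => p r 1) 1 t)
      _ _ _ _ _).
    + apply (is_derive_RInt_gt (q t) 0); [lra | easy | now apply Cq].
    + apply @is_derive_const.
  - now apply (gradient_continuity _ _ _ Hp).
  - now apply (gradient_continuity _ _ _ Hq).
Qed.

(** * D'Alembert representation of an arbitrary solution *)

(** [x * a = w_r] and [sqrt 3 * x ^ 2 * b = w - x * w_x] for
    [w = F (x + r) + G (x - r)] and [r = t / sqrt 3]. *)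
Definition dalembert (F f G g : R -> R) (a b : R -> R -> R) : Prop :=
  (forall y, 0 < y -> is_derive F y (f y) /\ continuous f y) /\
  (forall y, is_derive G y (g y) /\ continuous g y) /\
  (forall t x, 0 < t -> 0 < x ->
     a t x = (f (x + t / sqrt 3) - g (x - t / sqrt 3)) / x /\
     b t x = (F (x + t / sqrt 3) + G (x - t / sqrt 3)
              - x * (f (x + t / sqrt 3) + g (x - t / sqrt 3)))
             / (sqrt 3 * x ^ 2)).

(** The quantities [P] and [Q] are transported along characteristics, so each is a function of one
    variable; half of [P] and minus half of [Q] are the derivatives of the two profiles, which are
    then integrated. *)
Lemma dalembert_exists (a b : R -> R -> R) :
  C1_quadrant a -> C1_quadrant b -> linear_system a b ->
  exists F f G g, dalembert F f G g a b.
Proof.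
  intros HCa HCb Hsys.
  pose proof (C1_quadrant_gradient _ HCa) as Ha.
  pose proof (C1_quadrant_gradient _ HCb) as Hb.
  set (aT := fun t x => Derive (fun s => a s x) t) in Ha.
  set (ax := fun t x => Derive (fun y => a t y) x) in Ha.
  set (bt := fun t x => Derive (fun s => b s x) t) in Hb.
  set (bx := fun t x => Derive (fun y => b t y) x) in Hb.
  clearbody aT ax bt bx.
  rewrite (linear_system_gradient _ _ _ _ _ _ Ha Hb) in Hsys.
  pose proof sqrt3_pos as Hs; pose proof sqrt3_sqr as Hs2.
  set (s := sqrt 3) in *.
  set (c := / s).
  assert (Hc : 0 < c) by now apply Rinv_0_lt_compat.
  assert (Hcs : c * s = 1) by (apply Rinv_l; lra).
  assert (H3c : 3 * c = s) by (rewrite <- Hs2; nra).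
  (* Since [3 * c = s], the second equation says exactly that [c * a dt - s * b dx] is closed. *)
  assert (Hphi : exists phi, has_gradient phi (fun t x => c * a t x)
                                              (fun t x => - s * b t x)).
  { apply (gradient_potential _ _ (fun t x => c * aT t x) (fun t x => c * ax t x)
             (fun t x => - s * bx t x)).
    - now apply gradient_scal.
    - apply gradient_ext with (1 := gradient_scal (- s) _ _ _ Hb).
      intros t x Ht Hx. destruct (Hsys t x Ht Hx) as [_ E]. repeat split.
      replace (ax t x) with (- (3 * bt t x)) by lra.
      rewrite <- H3c; ring. }
  destruct Hphi as [phi Hphi].
  pose proof (gradient_mult _ _ _ _ _ _ (gradient_affine 0 1 0) Hphi) as Hw.
  pose proof (gradient_mult _ _ _ _ _ _ (gradient_affine 0 1 0) Ha) as Hxa.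
  pose proof (gradient_mult _ _ _ _ _ _ (gradient_affine 0 1 0)
                (gradient_scal (- s) _ _ _ Hb)) as Hxb.
  (* With [w = x * phi] and [r = c * t] these are [w_r + w_x] and [w_r - w_x]. *)
  set (P := fun t x => x * a t x + phi t x - s * x * b t x).
  set (Q := fun t x => x * a t x - phi t x + s * x * b t x).
  assert (HP : exists Pt Px, has_gradient P Pt Px /\
     forall t x, 0 < t -> 0 < x -> Pt t x = c * Px t x).
  { eexists _, _. split.
    - apply gradient_ext with
        (1 := gradient_plus _ _ _ _ _ _ Hxa (gradient_plus _ _ _ _ _ _ Hphi Hxb)).
      intros t x _ _. split; [unfold P; ring | split; reflexivity].
    - intros t x Ht Hx. destruct (Hsys t x Ht Hx) as [E1 E2]; simpl.
      apply Rminus_diag_uniq.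
      (* The first equation minus [c * x] times the second, corrected by multiples of [c * s - 1]
         and [3 * c - s], which are zero. *)
      transitivity ((x * aT t x + x * bx t x + 2 * b t x)
        + (c * s - 1) * (2 * b t x + x * bx t x) - c * x * (3 * bt t x + ax t x)
        + (3 * c - s) * x * bt t x); [ring | rewrite E1, E2, Hcs, H3c; ring]. }
  assert (HQ : exists Qt Qx, has_gradient Q Qt Qx /\
     forall t x, 0 < t -> 0 < x -> Qt t x = - c * Qx t x).
  { eexists _, _. split.
    - apply gradient_ext with
        (1 := gradient_plus _ _ _ _ _ _ Hxa
                (gradient_scal (- 1) _ _ _ (gradient_plus _ _ _ _ _ _ Hphi Hxb))).
      intros t x _ _. split; [unfold Q; ring | split; reflexivity].
    - intros t x Ht Hx. destruct (Hsys t x Ht Hx) as [E1 E2]; simpl.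
      apply Rminus_diag_uniq.
      transitivity ((x * aT t x + x * bx t x + 2 * b t x)
        + (c * s - 1) * (2 * b t x + x * bx t x) + c * x * (3 * bt t x + ax t x)
        - (3 * c - s) * x * bt t x); [ring | rewrite E1, E2, Hcs, H3c; ring]. }
  destruct HP as (Pt & Px & HP & EP), HQ as (Qt & Qx & HQ & EQ).
  (* The characteristic [x + r = y] with [y > 0] is sampled at its midpoint [x = r = y / 2]. *)
  set (f := fun y => P (y / 2 * s) (y / 2) / 2).
  (* The characteristic [x - r = y] exists for every real [y]; the choice [r = Rabs y + 1] makes
     both [r] and [x = y + r] positive. *)
  set (g := fun y => - Q ((Rabs y + 1) * s) (y + (Rabs y + 1)) / 2).
  assert (Ef : forall t x, 0 < t -> 0 < x -> P t x = 2 * f (x + t * c)).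
  { intros t x Ht Hx. unfold f.
    assert (0 < t * c) by now apply Rmult_lt_0_compat.
    set (y := x + t * c).
    assert (Hy : 0 < y) by (unfold y; lra).
    rewrite (gradient_constant_on_segment P Pt Px t x (y / 2 * s) (y / 2));
      trivial; try nra.
    intros t' x' Ht' Hx'. rewrite EP; trivial.
    (* The directional derivative is [Px] times the increment of [x + c * t] between the endpoints,
       which lie on the same characteristic. *)
    transitivity (Px t' x' * ((c * s) * (y / 2) - t * c + (y / 2 - x))); [ring | ].
    rewrite Hcs; unfold y; field. }
  assert (Eg : forall t x, 0 < t -> 0 < x -> Q t x = - 2 * g (x - t * c)).
  { intros t x Ht Hx. unfold g.
    set (y := x - t * c).
    pose proof (Rabs_pos y). pose proof (Rle_abs (- y)) as Hy.
    rewrite Rabs_Ropp in Hy.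
    rewrite (gradient_constant_on_segment Q Qt Qx t x
               ((Rabs y + 1) * s) (y + (Rabs y + 1))); trivial; try nra.
    intros t' x' Ht' Hx'. rewrite EQ; trivial.
    transitivity (Qx t' x' * (- (c * s) * (Rabs y + 1) + t * c
                   + (y + (Rabs y + 1) - x))); [ring | ].
    rewrite Hcs; unfold y; field. }
  assert (Cf : forall y, 0 < y -> continuous f y).
  (* In the definition of [f] the time varies with [y]. Near a given [y], [f] is instead read off
     from [P] at one fixed time, where smoothness in [x] applies. *)
  { intros y Hy. set (t := y / 2 * s).
    assert (Ht : 0 < t) by (unfold t; nra).
    assert (Htc : y - t * c = y / 2)
      by (unfold t; replace (y / 2 * s * c) with (y / 2 * (c * s)) by ring;
          rewrite Hcs; field).
    apply (continuous_ext_gt (fun z => / 2 * P t (z - t * c)) _ (t * c)).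
    - lra.
    - intros z Hz. rewrite Ef; [ | easy | lra].
      replace (z - t * c + t * c) with z by ring. field.
    - apply (ex_derive_continuous (fun z => / 2 * P t (z - t * c))).
      auto_derive. eexists; apply HP; lra. }
  assert (Cg : forall y, continuous g y).
  { intros y. set (t := (Rabs y + 1) * s).
    pose proof (Rabs_pos y). pose proof (Rle_abs (- y)) as Hy.
    rewrite Rabs_Ropp in Hy.
    assert (Ht : 0 < t) by (unfold t; nra).
    assert (Htc : t * c = Rabs y + 1)
      by (unfold t; rewrite Rmult_assoc, (Rmult_comm s), Hcs; ring).
    apply (continuous_ext_gt (fun z => - / 2 * Q t (z + t * c)) _ (- (t * c))).
    - lra.
    - intros z Hz. rewrite Eg; [ | easy | lra].
      replace (z + t * c - t * c) with z by ring. field.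
    - apply (ex_derive_continuous (fun z => - / 2 * Q t (z + t * c))).
      auto_derive. eexists; apply HQ; lra. }
  set (F := RInt f 1). set (G := RInt g 0).
  assert (DF : forall y, 0 < y -> is_derive F y (f y))
    by (intros y Hy; apply (is_derive_RInt_gt f 0); [lra | easy | exact Cf]).
  assert (DG : forall y, is_derive G y (g y))
    by (intros y; now apply is_derive_RInt_continuous).
  (* The defect between [w] and the sum of the two waves has zero gradient, hence is a constant; it
     is absorbed into [F] below. *)
  set (D := fun t x => x * phi t x - F (x + t * c) - G (x - t * c)).
  assert (HD : has_gradient D (fun _ _ => 0) (fun _ _ => 0)).
  { assert (HF : has_gradient (fun t x => F (c * t + 1 * x + 0))
                  (fun t x => c * f (c * t + 1 * x + 0))
                  (fun t x => 1 * f (c * t + 1 * x + 0))).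
    { apply (gradient_comp F f) with (1 := gradient_affine c 1 0).
      intros t x Ht Hx. assert (0 < c * t + 1 * x + 0) by nra. auto. }
    assert (HG : has_gradient (fun t x => G (- c * t + 1 * x + 0))
                  (fun t x => - c * g (- c * t + 1 * x + 0))
                  (fun t x => 1 * g (- c * t + 1 * x + 0))).
    { apply (gradient_comp G g) with (1 := gradient_affine (- c) 1 0); auto. }
    apply gradient_ext with
      (1 := gradient_plus _ _ _ _ _ _ Hw
              (gradient_scal (- 1) _ _ _ (gradient_plus _ _ _ _ _ _ HF HG))).
    intros t x Ht Hx. pose proof (Ef t x Ht Hx) as E1.
    pose proof (Eg t x Ht Hx) as E2. unfold P, Q, D in *.
    replace (c * t + 1 * x + 0) with (x + t * c) by ring.
    replace (- c * t + 1 * x + 0) with (x - t * c) by ring.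
    split; [ring | split; [ | lra]].
    replace (f (x + t * c)) with
      ((x * a t x + phi t x - s * x * b t x) / 2) by lra.
    replace (g (x - t * c)) with
      (- (x * a t x - phi t x + s * x * b t x) / 2) by lra.
    field. }
  exists (fun y => F y + D 1 1), f, G, g. split; [ | split].
  - intros y Hy. split; [ | now apply Cf].
    replace (f y) with (f y + 0) by ring.
    apply (is_derive_plus F (fun _ => D 1 1)); [now apply DF | apply @is_derive_const].
  - auto.
  - intros t x Ht Hx. pose proof (Ef t x Ht Hx) as E1.
    pose proof (Eg t x Ht Hx) as E2. change (t / sqrt 3) with (t * c).
    change (sqrt 3) with s.
    assert (ED : D t x = D 1 1)
      by (apply (gradient_constant_on_segment D _ _ t x 1 1 HD); trivial;
          try lra; intros; ring).
    unfold P, Q in *. split.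
    + replace (f (x + t * c) - g (x - t * c)) with (x * a t x) by lra.
      field; lra.
    + rewrite <- ED; unfold D.
      replace (x * (f (x + t * c) + g (x - t * c)))
        with (x * (phi t x - s * x * b t x)) by (f_equal; lra).
      field; lra.
Qed.

(** * Boundary values at [t = 0] and at the centre [x = 0] *)

Lemma filterlim_at_right_continuous (u v : R -> R) (m l : R) :
  (forall y, m < y -> u y = v y) -> continuous u m -> u m = l ->
  filterlim v (at_right m) (locally l).
Proof.
  intros E Hu <-.
  apply (filterlim_within_ext _ u); [exact E | ].
  exact (filterlim_filter_le_1 _ (filter_le_within _) Hu).
Qed.

Lemma continuous_affine_comp (h : R -> R) (k c x : R) :
  continuous h (k * x + c) -> continuous (fun y => h (k * y + c)) x.
Proof.
  intros Hh. apply (continuous_comp (fun y => k * y + c)); trivial.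
  apply (ex_derive_continuous (fun y => k * y + c)). now auto_derive.
Qed.

Lemma dalembert_initial (F f G g : R -> R) (a b : R -> R -> R) (x : R) :
  dalembert F f G g a b -> 0 < x ->
  filterlim (fun t => a t x) (at_right 0) (locally ((f x - g x) / x)) /\
  filterlim (fun t => b t x) (at_right 0)
    (locally ((F x + G x - x * (f x + g x)) / (sqrt 3 * x ^ 2))).
Proof.
  intros (HF & HG & E) Hx.
  pose proof sqrt3_pos as Hs.
  assert (Cf : continuous (fun t => f (/ sqrt 3 * t + x)) 0)
    by (apply continuous_affine_comp; rewrite Rmult_0_r, Rplus_0_l; now apply HF).
  assert (Cg : continuous (fun t => g (- / sqrt 3 * t + x)) 0)
    by (apply continuous_affine_comp; apply HG).
  assert (CF : continuous (fun t => F (/ sqrt 3 * t + x)) 0).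
  { apply continuous_affine_comp; rewrite Rmult_0_r, Rplus_0_l.
    apply (ex_derive_continuous F). eexists; now apply HF. }
  assert (CG : continuous (fun t => G (- / sqrt 3 * t + x)) 0).
  { apply continuous_affine_comp. apply (ex_derive_continuous G).
    eexists; apply HG. }
  assert (E1 : forall t, x + t / sqrt 3 = / sqrt 3 * t + x) by (intros; field; lra).
  assert (E2 : forall t, x - t / sqrt 3 = - / sqrt 3 * t + x) by (intros; field; lra).
  split.
  - apply (filterlim_at_right_continuous (fun t =>
      (f (/ sqrt 3 * t + x) - g (- / sqrt 3 * t + x)) * / x)).
    + intros t Ht. rewrite (proj1 (E t x Ht Hx)), E1, E2. reflexivity.
    + apply (continuous_mult (K := R_AbsRing)); [ | apply continuous_const].
      now apply (continuous_minus (V := R_NormedModule)).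
    + rewrite !Rmult_0_r, !Rplus_0_l. reflexivity.
  - apply (filterlim_at_right_continuous (fun t =>
      (F (/ sqrt 3 * t + x) + G (- / sqrt 3 * t + x)
       - x * (f (/ sqrt 3 * t + x) + g (- / sqrt 3 * t + x))) * / (sqrt 3 * x ^ 2))).
    + intros t Ht. rewrite (proj2 (E t x Ht Hx)), E1, E2. reflexivity.
    + apply (continuous_mult (K := R_AbsRing)); [ | apply continuous_const].
      apply (continuous_minus (V := R_NormedModule)).
      * now apply (continuous_plus (V := R_NormedModule)).
      * apply (continuous_mult (K := R_AbsRing)); [apply continuous_const | ].
        now apply (continuous_plus (V := R_NormedModule)).
    + rewrite !Rmult_0_r, !Rplus_0_l. reflexivity.
Qed.

(** As [x] tends to 0, [f] stays near [f r] with [r > 0] and [g] near [g (- r)], so the term with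
    factor [x] disappears. Absence of flux thus becomes the reflection law [F r + G (- r) = 0]. *)
Lemma dalembert_centre (F f G g : R -> R) (a b : R -> R -> R) (t : R) :
  dalembert F f G g a b -> 0 < t ->
  filterlim (fun x => x ^ 2 * b t x) (at_right 0)
    (locally ((F (t / sqrt 3) + G (- (t / sqrt 3))) / sqrt 3)).
Proof.
  intros (HF & HG & E) Ht.
  pose proof sqrt3_pos as Hs.
  assert (Hr : 0 < t / sqrt 3) by now apply Rdiv_lt_0_compat.
  set (r := t / sqrt 3) in *.
  assert (E0 : 1 * 0 + r = r) by ring.
  apply (filterlim_at_right_continuous (fun x =>
    (F (1 * x + r) + G (1 * x + - r) - x * (f (1 * x + r) + g (1 * x + - r)))
     * / sqrt 3)).
  - intros x Hx. rewrite (proj2 (E t x Ht Hx)). fold r.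
    replace (1 * x + r) with (x + r) by ring.
    replace (1 * x + - r) with (x - r) by ring. field; lra.
  - assert (Cf : continuous (fun x => f (1 * x + r)) 0)
      by (apply continuous_affine_comp; rewrite E0; now apply HF).
    assert (Cg : continuous (fun x => g (1 * x + - r)) 0)
      by (apply continuous_affine_comp; apply HG).
    assert (CF : continuous (fun x => F (1 * x + r)) 0).
    { apply continuous_affine_comp; rewrite E0.
      apply (ex_derive_continuous F). eexists; now apply HF. }
    assert (CG : continuous (fun x => G (1 * x + - r)) 0).
    { apply continuous_affine_comp. apply (ex_derive_continuous G).
      eexists; apply HG. }
    apply (continuous_mult (K := R_AbsRing)); [ | apply continuous_const].
    apply (continuous_minus (V := R_NormedModule)).
    + now apply (continuous_plus (V := R_NormedModule)).
    + apply (continuous_mult (K := R_AbsRing)); [apply continuous_id | ].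
      now apply (continuous_plus (V := R_NormedModule)).
  - rewrite E0. replace (1 * 0 + - r) with (- r) by ring.
    rewrite Rmult_0_l, Rminus_0_r. reflexivity.
Qed.

Lemma filterlim_at_right_unique (u : R -> R) (m l1 l2 : R) :
  filterlim u (at_right m) (locally l1) ->
  filterlim u (at_right m) (locally l2) -> l1 = l2.
Proof. exact (filterlim_locally_unique (V := R_NormedModule) u l1 l2). Qed.

(** * Uniqueness *)

(** On positive arguments [F - G] is constant and [F + G] is proportional to [y], so both profiles
    are affine with the same slope. Reflection carries the formula for [G] to negative arguments and
    continuity carries it to 0. *)
Lemma profiles_of_zero_data (F f G g : R -> R) :
  (forall y, 0 < y -> is_derive F y (f y)) ->
  (forall y, is_derive G y (g y)) ->
  (forall x, 0 < x -> f x = g x) ->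
  (forall x, 0 < x -> F x + G x = x * (f x + g x)) ->
  (forall r, 0 < r -> F r + G (- r) = 0) ->
  exists k, (forall y, 0 < y -> f y = k) /\ (forall y, g y = k) /\
    (forall y z, 0 < y -> F y + G z = k * (y + z)).
Proof.
  intros HF HG Hd Hs Hc.
  assert (const : forall (h : R -> R),
    (forall y, 0 < y -> is_derive h y 0) -> forall y, 0 < y -> h y = h 1).
  { intros h Hh y Hy. destruct (Rtotal_order y 1) as [H | [-> | H]]; trivial.
    - apply (eq_is_derive h); trivial. intros z Hz; apply Hh; lra.
    - symmetry; apply (eq_is_derive h); trivial. intros z Hz; apply Hh; lra. }
  set (C := F 1 - G 1). set (K := F 1 + G 1).
  assert (EC : forall y, 0 < y -> F y - G y = C).
  { apply (const (fun y => F y - G y)). intros y Hy.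
    replace 0 with (f y - g y) by (rewrite Hd; trivial; ring).
    apply (is_derive_minus F G); auto. }
  assert (EK : forall y, 0 < y -> F y + G y = K * y).
  { intros y Hy.
    enough (E : (F y + G y) / y = (F 1 + G 1) / 1)
      by (unfold K; rewrite Rdiv_1_r in E; rewrite <- E; field; lra).
    apply (const (fun y => (F y + G y) / y)); trivial. clear y Hy; intros y Hy.
    (* The relation [S = y * S'] for [S = F + G] is the vanishing of the numerator in the derivative
       of [S / y]. *)
    replace 0 with (((f y + g y) * y - (F y + G y) * 1) / y ^ 2)
      by (rewrite Hs; trivial; field; lra).
    apply (is_derive_div (fun y => F y + G y) (fun y => y)); [ | | lra].
    - apply (is_derive_plus F G); auto.
    - apply @is_derive_id. }
  assert (EG : forall y, y <> 0 -> G y = / 2 * (K * y - C)).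
  { intros y Hy. destruct (Rdichotomy y 0 Hy) as [H | H].
    - assert (H' : 0 < - y) by lra. pose proof (Hc (- y) H') as E.
      rewrite Ropp_involutive in E.
      pose proof (EC (- y) H'); pose proof (EK (- y) H'); lra.
    - pose proof (EC y H); pose proof (EK y H); lra. }
  assert (EG0 : G 0 = / 2 * (K * 0 - C)).
  { apply (filterlim_at_right_unique G 0).
    - apply (filterlim_at_right_continuous G); trivial.
      apply (ex_derive_continuous G); eexists; apply HG.
    - apply (filterlim_at_right_continuous (fun y => / 2 * (K * y - C))); trivial.
      + intros y Hy; symmetry; apply EG; lra.
      + apply (ex_derive_continuous (fun y => / 2 * (K * y - C))). now auto_derive. }
  assert (EG' : forall y, G y = / 2 * (K * y - C))
    by (intros y; destruct (Req_dec y 0) as [-> | H]; auto).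
  assert (Eg : forall y, g y = K / 2).
  { intros y. rewrite <- (is_derive_unique _ _ _ (HG y)).
    apply is_derive_unique, (is_derive_ext (fun y => / 2 * (K * y - C)));
      [now intros; rewrite EG' | auto_derive; trivial; field]. }
  exists (K / 2). repeat split.
  - intros y Hy; rewrite Hd; auto.
  - exact Eg.
  - intros y z Hy. pose proof (EC y Hy). pose proof (EK y Hy). rewrite EG'. lra.
Qed.

(** Both sets of profiles satisfy the same linear conditions, so their differences have zero data
    and are affine; such a difference is invisible in [a] and [b]. *)
Lemma dalembert_unique (a0 b0 : R -> R) (F1 f1 G1 g1 F2 f2 G2 g2 : R -> R)
  (a1 b1 a2 b2 : R -> R -> R) :
  dalembert F1 f1 G1 g1 a1 b1 -> dalembert F2 f2 G2 g2 a2 b2 ->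
  initial_conditions a0 b0 a1 b1 -> initial_conditions a0 b0 a2 b2 ->
  no_flux_at_centre b1 -> no_flux_at_centre b2 ->
  forall t x, 0 < t -> 0 < x -> a1 t x = a2 t x /\ b1 t x = b2 t x.
Proof.
  intros H1 H2 I1 I2 N1 N2.
  pose proof sqrt3_pos as Hs.
  assert (L : forall F f G g a b, dalembert F f G g a b ->
    initial_conditions a0 b0 a b -> no_flux_at_centre b ->
    (forall x, 0 < x -> f x - g x = x * a0 x) /\
    (forall x, 0 < x -> F x + G x - x * (f x + g x) = sqrt 3 * x ^ 2 * b0 x) /\
    (forall r, 0 < r -> F r + G (- r) = 0)).
  { intros F f G g a b H I N. split; [ | split].
    - intros x Hx.
      rewrite (filterlim_at_right_unique _ _ _ _ (proj1 (I x Hx))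
                 (proj1 (dalembert_initial _ _ _ _ _ _ x H Hx))).
      field; lra.
    - intros x Hx.
      rewrite (filterlim_at_right_unique _ _ _ _ (proj2 (I x Hx))
                 (proj2 (dalembert_initial _ _ _ _ _ _ x H Hx))).
      field; lra.
    - intros r Hr. assert (Ht : 0 < r * sqrt 3) by now apply Rmult_lt_0_compat.
      pose proof (filterlim_at_right_unique _ _ _ _ (N _ Ht)
                    (dalembert_centre _ _ _ _ _ _ _ H Ht)) as E.
      replace (r * sqrt 3 / sqrt 3) with r in E by (field; lra).
      apply Rmult_eq_reg_r with (/ sqrt 3); [ | apply Rinv_neq_0_compat; lra].
      rewrite Rmult_0_l. now symmetry. }
  destruct (L _ _ _ _ _ _ H1 I1 N1) as (A1 & B1 & C1).
  destruct (L _ _ _ _ _ _ H2 I2 N2) as (A2 & B2 & C2).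
  destruct H1 as (HF1 & HG1 & E1), H2 as (HF2 & HG2 & E2).
  destruct (profiles_of_zero_data (fun y => F1 y - F2 y) (fun y => f1 y - f2 y)
              (fun y => G1 y - G2 y) (fun y => g1 y - g2 y)) as (k & Ef & Eg & EFG).
  - intros y Hy. apply (is_derive_minus F1 F2); [now apply HF1 | now apply HF2].
  - intros y. apply (is_derive_minus G1 G2); [apply HG1 | apply HG2].
  - intros x Hx. pose proof (A1 x Hx); pose proof (A2 x Hx); lra.
  - intros x Hx. pose proof (B1 x Hx); pose proof (B2 x Hx); lra.
  - intros r Hr. pose proof (C1 r Hr); pose proof (C2 r Hr); lra.
  - intros t x Ht Hx.
    assert (Hr : 0 < t / sqrt 3) by now apply Rdiv_lt_0_compat.
    destruct (E1 t x Ht Hx) as [-> ->], (E2 t x Ht Hx) as [-> ->].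
    set (y := x + t / sqrt 3) in *. set (z := x - t / sqrt 3) in *.
    assert (Hy : 0 < y) by (unfold y; lra).
    specialize (Ef y Hy); specialize (Eg z); specialize (EFG y z Hy).
    (* Hence the affine part of [F + G] is [2 * k * x], which cancels [x * (k + k)] in the numerator
       of [b]. *)
    assert (Hyz : y + z = 2 * x) by (unfold y, z; ring).
    rewrite Hyz in EFG.
    split; f_equal; [lra | nra].
Qed.

(** * Twice differentiable profiles give solutions *)

(** Since [a] and [b] contain [f] and [g], their gradients need [f'] and [g']. With these at hand
    the equations are algebraic identities, the second one modulo [3 * c * c = 1]. *)
Lemma dalembert_solves (F f f' G g g' : R -> R) (a b : R -> R -> R) :
  dalembert F f G g a b ->
  (forall y, is_derive f y (f' y) /\ continuous f' y) ->
  (forall y, is_derive g y (g' y) /\ continuous g' y) ->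
  C1_quadrant a /\ C1_quadrant b /\ linear_system a b.
Proof.
  intros (HF & HG & E) Hf Hg.
  pose proof sqrt3_pos as Hs; pose proof sqrt3_sqr as Hs2.
  set (c := / sqrt 3).
  assert (Hc : 0 < c) by now apply Rinv_0_lt_compat.
  assert (comp : forall k H h, (forall t x, 0 < t -> 0 < x ->
     is_derive H (k * t + 1 * x + 0) (h (k * t + 1 * x + 0)) /\
     continuous h (k * t + 1 * x + 0)) ->
     has_gradient (fun t x => H (x + k * t)) (fun t x => k * h (x + k * t))
       (fun t x => h (x + k * t))).
  { intros k H h Hh.
    apply gradient_ext with (1 := gradient_comp H h _ _ _ (gradient_affine k 1 0) Hh).
    intros t x _ _. replace (k * t + 1 * x + 0) with (x + k * t) by ring.
    repeat split; ring. }
  assert (GF : has_gradient (fun t x => F (x + c * t)) (fun t x => c * f (x + c * t))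
                 (fun t x => f (x + c * t))).
  { apply comp. intros t x Ht Hx. apply HF. nra. }
  pose proof (comp c f f' (fun _ _ _ _ => Hf _)) as Gf.
  pose proof (comp (- c) G g (fun _ _ _ _ => HG _)) as GG.
  pose proof (comp (- c) g g' (fun _ _ _ _ => Hg _)) as Gg.
  assert (Gi : has_gradient (fun _ x => / x) (fun _ _ => 0) (fun _ x => - / x ^ 2)).
  { assert (Hi : forall t x, 0 < t -> 0 < x ->
      is_derive Rinv (0 * t + 1 * x + 0) (- / (0 * t + 1 * x + 0) ^ 2) /\
      continuous (fun y => - / y ^ 2) (0 * t + 1 * x + 0)).
    { intros t x Ht Hx. replace (0 * t + 1 * x + 0) with x by ring. split.
      - auto_derive; [lra | field; lra].
      - apply (ex_derive_continuous (fun y => - / y ^ 2)). auto_derive.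
        rewrite Rmult_1_r; nra. }
    apply gradient_ext with (1 := gradient_comp Rinv _ _ _ _ (gradient_affine 0 1 0) Hi).
    intros t x _ _. replace (0 * t + 1 * x + 0) with x by ring.
    repeat split; ring. }
  pose proof (gradient_mult _ _ _ _ _ _
    (gradient_plus _ _ _ _ _ _ Gf (gradient_scal (-1) _ _ _ Gg)) Gi) as Ga.
  pose proof (gradient_scal c _ _ _ (gradient_mult _ _ _ _ _ _
    (gradient_plus _ _ _ _ _ _
       (gradient_mult _ _ _ _ _ _ (gradient_plus _ _ _ _ _ _ GF GG) Gi)
       (gradient_scal (-1) _ _ _ (gradient_plus _ _ _ _ _ _ Gf Gg))) Gi)) as Gb.
  assert (Er : forall t x, x + t / sqrt 3 = x + c * t /\ x - t / sqrt 3 = x + - c * t)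
    by (intros t x; unfold c; split; field; lra).
  eapply gradient_ext in Ga.
  2:{ intros t x Ht Hx. split; [ | split; reflexivity].
      rewrite (proj1 (E t x Ht Hx)).
      destruct (Er t x) as [-> ->]. field; lra. }
  eapply gradient_ext in Gb.
  2:{ intros t x Ht Hx. split; [ | split; reflexivity].
      rewrite (proj2 (E t x Ht Hx)).
      destruct (Er t x) as [-> ->]. unfold c; field; lra. }
  split; [ | split].
  - exact (gradient_C1_quadrant _ _ _ Ga).
  - exact (gradient_C1_quadrant _ _ _ Gb).
  - rewrite (linear_system_gradient _ _ _ _ _ _ Ga Gb).
    intros t x Ht Hx. rewrite (proj2 (E t x Ht Hx)).
    destruct (Er t x) as [-> ->].
    assert (H3 : 3 * c * c = 1).
    { replace (3 * c * c) with (3 * / (sqrt 3 * sqrt 3)) by (unfold c; field; lra).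
      rewrite Hs2; field. }
    split.
    + unfold c; field; lra.
    + transitivity ((3 * c * c - 1) *
        ((f (x + c * t) - g (x + - c * t)) / x ^ 2
         - (f' (x + c * t) - g' (x + - c * t)) / x)).
      * field; lra.
      * rewrite H3; ring.
Qed.

(** * The primitives and profiles of the stated formulas *)

(** Substitution of [- y] for [y]. It makes [A_prim] and [B_prim] even, which yields the reflection
    law for the explicit profiles. *)
Lemma RInt_odd (h : R -> R) (x : R) :
  (forall y, continuous h y) -> odd_fun h -> RInt h 0 (- x) = RInt h 0 x.
Proof.
  intros Ch Hodd. symmetry.
  apply is_RInt_unique.
  apply is_RInt_ext with (fun y => opp (h (- y))).
  - intros y _. rewrite Hodd. apply Ropp_involutive.
  - apply (is_RInt_comp_opp h 0 x). rewrite Ropp_0.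
    apply (RInt_correct (V := R_CompleteNormedModule)).
    apply (ex_RInt_continuous (V := R_CompleteNormedModule)); auto.
Qed.

Lemma C1_continuous (f : R -> R) : is_C1 f -> forall x, continuous f x.
Proof. intros Hf x. apply (ex_derive_continuous f), Hf. Qed.

Lemma C1_id_mult_continuous (f : R -> R) :
  is_C1 f -> forall x, continuous (fun u => u * f u) x.
Proof.
  intros Hf x. apply (continuous_mult (K := R_AbsRing)); [apply continuous_id | ].
  now apply C1_continuous.
Qed.

Lemma A_prim_derive (a0 : R -> R) (x : R) :
  is_C1 a0 -> is_derive (A_prim a0) x (x * a0 x).
Proof.
  intros Ha. apply (is_derive_RInt_continuous (fun u => u * a0 u)).
  now apply C1_id_mult_continuous.
Qed.

Lemma B_prim_derive (b0 : R -> R) (x : R) :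
  is_C1 b0 -> is_derive (B_prim b0) x (b0 x).
Proof.
  intros Hb. apply is_derive_RInt_continuous. now apply C1_continuous.
Qed.

(** [k] is [- sqrt 3] for the wave [F] and [sqrt 3] for [- G]. *)
Lemma profile_derive (a0 b0 : R -> R) (k y : R) :
  is_C1 a0 -> is_C1 b0 ->
  is_derive (fun y => A_prim a0 y + k * (y * B_prim b0 y)) y
    (y * a0 y + k * (y * b0 y + B_prim b0 y)).
Proof.
  intros Ha Hb.
  pose proof (A_prim_derive a0 y Ha) as DA.
  pose proof (B_prim_derive b0 y Hb) as DB.
  replace (y * b0 y + B_prim b0 y) with (1 * B_prim b0 y + y * b0 y) by ring.
  apply (is_derive_plus (A_prim a0) (fun y => k * (y * B_prim b0 y))); trivial.
  apply (is_derive_scal (fun y => y * B_prim b0 y)).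
  apply (is_derive_mult (fun y => y) (B_prim b0)); trivial.
  - apply @is_derive_id.
  - exact Rmult_comm.
Qed.

Lemma profile_derive2 (a0 b0 : R -> R) (k y : R) :
  is_C1 a0 -> is_C1 b0 ->
  is_derive (fun y => y * a0 y + k * (y * b0 y + B_prim b0 y)) y
    (a0 y + y * Derive a0 y + k * (2 * b0 y + y * Derive b0 y)) /\
  continuous
    (fun y => a0 y + y * Derive a0 y + k * (2 * b0 y + y * Derive b0 y)) y.
Proof.
  intros Ha Hb. split.
  - pose proof (Derive_correct _ _ (proj1 Ha y)) as Da.
    pose proof (Derive_correct _ _ (proj1 Hb y)) as Db.
    pose proof (B_prim_derive b0 y Hb) as DB.
    replace (a0 y + y * Derive a0 y + k * (2 * b0 y + y * Derive b0 y))
      with (1 * a0 y + y * Derive a0 y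
            + k * (1 * b0 y + y * Derive b0 y + b0 y)) by ring.
    assert (D : forall h l, is_derive h y l ->
              is_derive (fun y => y * h y) y (1 * h y + y * l)).
    { intros h l Hl. apply (is_derive_mult (fun y => y) h); trivial.
      - apply @is_derive_id.
      - exact Rmult_comm. }
    apply (is_derive_plus (fun y => y * a0 y)); [now apply D | ].
    apply (is_derive_scal (fun y => y * b0 y + B_prim b0 y)).
    apply (is_derive_plus (fun y => y * b0 y)); [now apply D | trivial].
  - assert (D : forall h, continuous h y -> continuous (fun y => y * h y) y).
    { intros h Hh. apply (continuous_mult (K := R_AbsRing)); trivial.
      apply continuous_id. }
    pose proof (C1_continuous a0 Ha y). pose proof (C1_continuous b0 Hb y).
    pose proof (D _ (proj2 Ha y)). pose proof (D _ (proj2 Hb y)).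
    apply (continuous_plus (V := R_NormedModule)).
    + now apply (continuous_plus (V := R_NormedModule)).
    + apply (continuous_mult (K := R_AbsRing)); [apply continuous_const | ].
      apply (continuous_plus (V := R_NormedModule)); trivial.
      now apply (continuous_mult (K := R_AbsRing)); [apply continuous_const | ].
Qed.

(** At equal arguments [f - g = y * a0 y] and [F + G = - sqrt 3 * y * B_prim b0 y], so that [F + G -
    y * (f + g) = sqrt 3 * y ^ 2 * b0 y]: these profiles encode the initial data. *)
Lemma formula_dalembert (a0 b0 : R -> R) :
  is_C1 a0 -> is_C1 b0 ->
  dalembert
    (fun y => / 2 * (A_prim a0 y + - sqrt 3 * (y * B_prim b0 y)))
    (fun y => / 2 * (y * a0 y + - sqrt 3 * (y * b0 y + B_prim b0 y)))
    (fun y => - / 2 * (A_prim a0 y + sqrt 3 * (y * B_prim b0 y)))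
    (fun y => - / 2 * (y * a0 y + sqrt 3 * (y * b0 y + B_prim b0 y)))
    (a_formula a0 b0) (b_formula a0 b0).
Proof.
  intros Ha Hb.
  pose proof sqrt3_pos as Hs; pose proof sqrt3_sqr as Hs2.
  assert (D : forall k l y,
    is_derive (fun y => l * (A_prim a0 y + k * (y * B_prim b0 y))) y
      (l * (y * a0 y + k * (y * b0 y + B_prim b0 y))) /\
    continuous (fun y => l * (y * a0 y + k * (y * b0 y + B_prim b0 y))) y).
  { intros k l y. split.
    - apply (is_derive_scal (fun y => A_prim a0 y + k * (y * B_prim b0 y))).
      now apply profile_derive.
    - apply (continuous_mult (K := R_AbsRing)); [apply continuous_const | ].
      apply (ex_derive_continuous
               (fun y => y * a0 y + k * (y * b0 y + B_prim b0 y))).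
      eexists. now apply profile_derive2. }
  split; [ | split].
  - intros y _; apply D.
  - intros y; apply D.
  (* In [b], the [B_prim] terms of [F] and [x * f] combine from the factors [x + r] and [x] to the
     factor [r]; likewise for [G] and [g]. *)
  - intros t x Ht Hx. unfold a_formula, b_formula. cbv zeta.
    set (r := t / sqrt 3). split; field; lra.
Qed.

(** * Existence and uniqueness for the stated formulas *)

Theorem theorem3p1 (a0 b0 : R -> R)
  (Ha0 : is_C1 a0) (Hb0 : is_C1 b0) (Ha0_even : even_fun a0) (Hb0_odd : odd_fun b0) :
  is_solution a0 b0 (a_formula a0 b0) (b_formula a0 b0) /\
  (forall a b : R -> R -> R, is_solution a0 b0 a b ->
     forall t x, 0 < t -> 0 < x ->
       a t x = a_formula a0 b0 t x /\ b t x = b_formula a0 b0 t x).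
Proof.
  pose proof sqrt3_pos as Hs.
  pose proof (formula_dalembert a0 b0 Ha0 Hb0) as HD.
  assert (Sol : is_solution a0 b0 (a_formula a0 b0) (b_formula a0 b0)).
  { assert (D : forall k l y,
      is_derive (fun y => l * (y * a0 y + k * (y * b0 y + B_prim b0 y))) y
        (l * (a0 y + y * Derive a0 y + k * (2 * b0 y + y * Derive b0 y))) /\
      continuous (fun y => l * (a0 y + y * Derive a0 y
                                + k * (2 * b0 y + y * Derive b0 y))) y).
    { intros k l y. destruct (profile_derive2 a0 b0 k y Ha0 Hb0) as [D1 D2]. split.
      - now apply (is_derive_scal
                     (fun y => y * a0 y + k * (y * b0 y + B_prim b0 y))).
      - now apply (continuous_mult (K := R_AbsRing)); [apply continuous_const | ]. }
    destruct (dalembert_solves _ _ _ _ _ _ _ _ HD (D _ _) (D _ _)) as (Ca & Cb & S).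
    split; [exact Ca | split; [exact Cb | split; [exact S | split]]].
    - intros x Hx. destruct (dalembert_initial _ _ _ _ _ _ x HD Hx) as [La Lb]. split.
      + match type of La with filterlim _ _ (locally ?l) =>
          replace (a0 x) with l by (field; lra) end. exact La.
      + match type of Lb with filterlim _ _ (locally ?l) =>
          replace (b0 x) with l by (field; lra) end. exact Lb.
    - intros t Ht. pose proof (dalembert_centre _ _ _ _ _ _ t HD Ht) as L.
      cbv beta in L.
      (* Evenness of the primitives makes [F r] and [G (- r)] opposite, so the limiting flux is
         0. *)
      assert (EA : A_prim a0 (- (t / sqrt 3)) = A_prim a0 (t / sqrt 3)).
      { apply (RInt_odd (fun u => u * a0 u)); [now apply C1_id_mult_continuous | ].
        intros u. rewrite Ha0_even. ring. }
      assert (EB : B_prim b0 (- (t / sqrt 3)) = B_prim b0 (t / sqrt 3))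
        by (apply RInt_odd; [now apply C1_continuous | exact Hb0_odd]).
      match type of L with filterlim _ _ (locally ?l) =>
        replace l with 0 in L by (rewrite EA, EB; field; lra) end. exact L. }
  split; [exact Sol | ].
  intros a b HS.
  pose proof HS as (Ca & Cb & S & I & N).
  destruct Sol as (_ & _ & _ & I' & N').
  (* An arbitrary solution has profiles of its own, which are compared with the explicit ones. *)
  destruct (dalembert_exists a b Ca Cb S) as (F & f & G & g & HD').
  exact (dalembert_unique a0 b0 _ _ _ _ _ _ _ _ _ _ _ _ HD' HD I I' N N').
Qed.
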